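(* Let $\mathcal{R},\mathcal{S}$ be TRSs over $\mathcal{F}$ such that $\mathcal{R}\cup\mathcal{S}$ is non-duplicating and $\mathcal{R}$ is non-collapsing, and let $L\subseteq\mathcal{T}(\mathcal{F})$ be a set of ground terms. If $\mathcal{R}/\mathcal{S}$ is match-raise-RT-bounded for $L$, then $\to_{\mathcal{R}/\mathcal{S}}$ is terminating on $L$ and $\mathrm{cp}(n,\to_{\mathcal{R}/\mathcal{S}},L)=O(n)$.
   Context: $\to_{\mathcal{R}/\mathcal{S}}=\to_{\mathcal{S}}^*\cdot\to_{\mathcal{R}}\cdot\to_{\mathcal{S}}^*$; $\mathrm{cp}(n,\to,L)=\sup\{\mathrm{dl}(t,\to)\mid t\in L,|t|\le n\}$, $\mathrm{dl}(t,\to)=\sup\{m\mid\exists u,\ t\to^mu\}$. Non-duplicating: no variable occurs more often in $r$ than in $l$ for a rule $l\to r$; collapsing: some right-hand side is a variable. For $N\subseteq\mathbb{N}$, $\mathcal{F}_N$ has symbols $f_c$ ($f\in\mathcal{F},c\in N$); $\mathrm{lift}_c(f)=f_c$, $\mathrm{base}(f_c)=f$, $\mathrm{height}(f_c)=c$, extended to terms, sets, TRSs. $\mathrm{FPos}(t)$: positions of function symbols; $\|t\|$: number of function symbol occurrences. $\mathrm{match}(\mathcal{R})$: rules $l'\to\mathrm{lift}_c(r)$ with $l\to r\in\mathcal{R}$, $\mathrm{base}(l')=l$, $c=1+\min\{\mathrm{height}(l'(p))\mid p\in\mathrm{FPos}(l)\}$. $\mathrm{MATCHRT}^c(\mathcal{S})$: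 rules $l'\to\mathrm{lift}_d(r)$ with $\mathrm{base}(l')\to r\in\mathcal{S}$, where $d=\min\{c,\mathrm{height}(l'(\epsilon))\}$ if $\|\mathrm{base}(l')\|\ge\|r\|$ and $\mathrm{lift}_{\mathrm{height}(l'(\epsilon))}(\mathrm{base}(l'))=l'$, else $d=\min(\{c\}\cup\{1+\mathrm{height}(l'(p))\mid p\in\mathrm{FPos}(l')\})$. $\mathrm{Raise}(\mathcal{F})$: rules $f_c(x_1,\dots,x_n)\to f_{c+1}(x_1,\dots,x_n)$; $s\uparrow t$: least common $\to^*_{\mathrm{Raise}(\mathcal{F})}$-reduct of $s,t$ (least w.r.t. sum of lengths of joining sequences), extended to finite nonempty sets. For a TRS $\mathcal{T}$ over $\mathcal{F}_{\mathbb{N}}$: $s\rightsquigarrow_{\mathcal{T}}t$ iff there are $l\to r\in\mathcal{T}$, a position $p$, context $C$, terms $s_1,\dots,s_n$ with $l=C[x_1,\dots,x_n]$ (all variable occurrences displayed), $s|_p=C[s_1,\dots,s_n]$, $\mathrm{base}(s_i)=\mathrm{base}(s_j)$ whenever $x_i=x_j$, and $t=s[r\sigma]_p$ with $\sigma(x)=\uparrow\{s_i\mid x_i=x\}$ for $x\in\{x_1,\dots,x_n\}$, $\sigma(x)=x$ otherwise. Define $\rightsquigarrow_{\mathrm{matchRT}(\mathcal{R}/\mathcal{S},c)}=\rightsquigarrow^*_{\mathrm{MATCHRT}^c(\mathcal{S})}\cdot\rightsquigarrow_{\mathrm{match}(\mathcal{R})}\cdot\rightsquigarrow^*_{\mathrm{MATCHRT}^c(\mathcal{S})}$.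 $\mathrm{Succ}_{\to}(K)=\{t\text{ ground}\mid s\to^*t,\ s\in K\}$. $\mathcal{R}/\mathcal{S}$ is match-raise-RT-bounded for $L$ if there is $c\in\mathbb{N}$ such that all function symbols in terms of $\mathrm{Succ}_{\rightsquigarrow_{\mathrm{matchRT}(\mathcal{R}/\mathcal{S},c)}}(\mathrm{lift}_0(L))$ have height at most $c$.
   Formalization: The bound cp(n) = O(n) is stated for finite TRSs R and S only, since it fails for infinite ones (R = {a → g^k(b) | k} ∪ {g(x) → h(x)}, S empty, L = {a}); termination on L is stated for arbitrary R and S. *)

(* Defs.v *)
From Stdlib Require Import Relations.
From mathcomp Require Import all_boot.
From mathcomp Require Import boolp classical_sets functions cardinality.

Set Implicit Arguments.
Unset Strict Implicit.
Unset Printing Implicit Defensive.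

Local Open Scope classical_set_scope.

Record signature := Signature { sym :> Type; arity : sym -> nat }.

(* First-order terms over the variables 0, 1, 2, ...  Arities are not built
   into the type: the terms of T(F, V) are those satisfying [wf]. *)
Inductive term (F : Type) : Type :=
| Var of nat
| App of F & seq (term F).
Arguments Var {F}.

Section Terms.
Variable F : Type.
Implicit Types (t u : term F) (p : seq nat).

Fixpoint vars t : seq nat :=
  match t with
  | Var x => [:: x]
  | App _ ts => flatten [seq vars u | u <- ts]
  end.

Definition ground t : Prop := vars t = [::].

Fixpoint term_size t : nat :=
  match t with
  | Var _ => 1
  | App _ ts => (sumn [seq term_size u | u <- ts]).+1
  end.

Fixpoint fun_size t : nat :=
  match t with
  | Var _ => 0
  | App _ ts => (sumn [seq fun_size u | u <- ts]).+1
  end.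

Fixpoint subst (sigma : nat -> term F) t : term F :=
  match t with
  | Var x => sigma x
  | App f ts => App f [seq subst sigma u | u <- ts]
  end.

(* Positions are sequences of argument indices, counted from 0. *)
Fixpoint fpos t : seq (seq nat) :=
  match t with
  | Var _ => [::]
  | App _ ts =>
      [::] :: flatten [seq [seq ip.1 :: p | p <- ip.2]
                      | ip <- zip (iota 0 (size ts)) [seq fpos u | u <- ts]]
  end.

Fixpoint subterm_at t p : option (term F) :=
  match p, t with
  | [::], _ => Some t
  | i :: q, App _ ts => obind (fun u => subterm_at u q) (onth ts i)
  | _ :: _, Var _ => None
  end.

(* Only used at positions of [t]. *)
Fixpoint replace_at t p u : term F :=
  match p, t with
  | [::], _ => u
  | i :: q, App f ts =>
      App f (set_nth (Var 0) ts i (replace_at (nth (Var 0) ts i) q u))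
  | _ :: _, Var _ => t
  end.

(* A context with n holes is a term whose variables are the holes, which are
   numbered 0, ..., n - 1 from left to right; it has no other variables. *)
Definition is_mctxt (n : nat) (C : term F) : Prop := vars C = iota 0 n.

Definition fill (C : term F) (ts : seq (term F)) : term F :=
  subst (nth (Var 0) ts) C.

End Terms.

Fixpoint map_sym (F G : Type) (g : F -> G) (t : term F) : term G :=
  match t with
  | Var x => Var x
  | App f ts => App (g f) [seq map_sym g u | u <- ts]
  end.

Fixpoint wf (F : signature) (t : term F) : bool :=
  match t with
  | Var _ => true
  | App f ts => (size ts == arity f) && all (@wf F) ts
  end.

Definition ground_terms (F : signature) : set (term F) :=
  [set t | wf t /\ ground t].

(* A (possibly infinite) set of pairs of terms (l, r). *)
Definition rules (F : Type) := set (term F * term F).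

Definition is_TRS (F : signature) (R : rules F) : Prop :=
  forall l r, R (l, r) ->
    [/\ wf l, wf r, (forall x, l <> Var x) & {subset vars r <= vars l}].

Definition non_duplicating (F : Type) (R : rules F) : Prop :=
  forall l r, R (l, r) ->
    forall x, count_mem x (vars r) <= count_mem x (vars l).

Definition collapsing (F : Type) (R : rules F) : Prop :=
  exists l x, R (l, Var x).

Section Relations.
Variable T : Type.
Implicit Types (Rel : relation T).

Fixpoint rpow Rel (m : nat) (s t : T) : Prop :=
  if m is m'.+1 then exists2 u, Rel s u & rpow Rel m' u t else s = t.

Definition star Rel : relation T := clos_refl_trans T Rel.

(* S^* . R . S^* *)
Definition relative (RR RS : relation T) : relation T :=
  fun s t => exists u v, [/\ star RS s u, RR u v & star RS v t].

Definition terminating_on Rel (L : set T) : Prop :=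
  ~ exists2 a : nat -> T, L (a 0) & forall i, Rel (a i) (a i.+1).

End Relations.

Definition rstep (F : Type) (R : rules F) : relation (term F) :=
  fun s t => exists l r p sigma,
    [/\ R (l, r), subterm_at s p = Some (subst sigma l)
      & t = replace_at s p (subst sigma r)].

(* Natural numbers extended with infinity ([None]). *)
Definition enat := option nat.

Definition ele (a b : enat) : bool :=
  match a, b with
  | _, None => true
  | None, Some _ => false
  | Some m, Some n => m <= n
  end.

Definition esup (A : set enat) : enat :=
  if pselect (exists b : nat, `[< forall a, A a -> ele a (Some b) >]) is left e
  then Some (ex_minn e) else None.

Definition dl (T : Type) (t : T) (Rel : relation T) : enat :=
  esup [set a | exists m, a = Some m /\ exists u, rpow Rel m t u].

Definition cp (F : Type) (n : nat) (Rel : relation (term F))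
    (L : set (term F)) : enat :=
  esup [set a | exists t, [/\ L t, term_size t <= n & a = dl t Rel]].

Definition linearly_bounded (f : nat -> enat) : Prop :=
  exists K N : nat, forall n, N <= n -> ele (f n) (Some (K * n)).

(* The signature F_N for N the set of all natural numbers; the symbol f_c is
   the pair (f, c). *)
Definition lift_sig (F : signature) : signature :=
  @Signature (F * nat) (fun fc => arity fc.1).

Definition lift_term (F : Type) (c : nat) (t : term F) : term (F * nat) :=
  map_sym (fun f => (f, c)) t.

Definition base (F : Type) (t : term (F * nat)) : term F := map_sym fst t.

(* height(t(p)); the value 0 for p outside FPos(t) is never used. *)
Definition height_at (F : Type) (t : term (F * nat)) (p : seq nat) : nat :=
  if subterm_at t p is Some (App fc _) then fc.2 else 0.

(* Left-hand sides are not variables, so the root is in FPos(l) and its height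
   can serve as initial value of the minimum. *)
Definition match_rules (F : Type) (R : rules F) : rules (F * nat) :=
  [set rho | exists l r l', let c :=
       (\big[minn/height_at l' [::]]_(p <- fpos l) height_at l' p).+1 in
     [/\ R (l, r), base l' = l & rho = (l', lift_term c r)]].

Definition matchRT_rules (F : Type) (c : nat) (S : rules F) :
    rules (F * nat) :=
  [set rho | exists l' r, let h := height_at l' [::] in
     let d := if `[< fun_size r <= fun_size (base l')
                     /\ lift_term h (base l') = l' >]
              then minn c h
              else \big[minn/c]_(p <- fpos l') (height_at l' p).+1 in
     S (base l', r) /\ rho = (l', lift_term d r)].

Definition raise_rules (F : signature) : rules (F * nat) :=
  [set rho | exists (f : F) (c : nat), let xs := map Var (iota 0 (arity f)) in
     rho = (App (f, c) xs, App (f, c.+1) xs)].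

(* s `raise` t = u *)
Definition is_join (F : signature) (s t u : term (F * nat)) : Prop :=
  let raise := rstep (@raise_rules F) in
  exists m n, [/\ rpow raise m s u, rpow raise n t u
    & forall u' m' n', rpow raise m' s u' -> rpow raise n' t u' ->
        m + n <= m' + n'].

Fixpoint is_joins (F : signature) (ss : seq (term (F * nat)))
    (u : term (F * nat)) : Prop :=
  match ss with
  | [::] => False
  | [:: s] => u = s
  | s :: ss' => exists2 v, is_joins ss' v & @is_join F s v u
  end.

Definition raise_step (F : signature) (T : rules (F * nat)) :
    relation (term (F * nat)) :=
  fun s t => exists l r p C xs ss sigma,
    [/\ T (l, r),
        is_mctxt (size xs) C /\ size ss = size xs,
        l = fill C (map Var xs) /\ subterm_at s p = Some (fill C ss),
        forall i j, i < size xs -> j < size xs -> nth 0 xs i = nth 0 xs j ->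
          base (nth (Var 0) ss i) = base (nth (Var 0) ss j)
      & (forall x, if x \in xs
           then @is_joins F [seq xs_i.2 | xs_i <- zip xs ss & xs_i.1 == x]
                  (sigma x)
           else sigma x = Var x)
        /\ t = replace_at s p (subst sigma r)].

Definition matchRT_step (F : signature) (R S : rules F) (c : nat) :
    relation (term (F * nat)) :=
  relative (@raise_step F (match_rules R))
           (@raise_step F (matchRT_rules c S)).

Definition Succ (F : Type) (Rel : relation (term F)) (K : set (term F)) :
    set (term F) :=
  [set t | ground t /\ exists2 s, K s & star Rel s t].

Definition match_raise_RT_bounded (F : signature) (R S : rules F)
    (L : set (term F)) : Prop :=
  exists c : nat, forall t,
    Succ (matchRT_step R S c) [set lift_term 0 s | s in L] t ->
    forall p, p \in fpos t -> height_at t p <= c.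

(* Main.v *)
(* Give a symbol of height h a weight w h, where w is antitone and vanishes from
   the height c on. Raising a term never increases its weight, and the rules do
   not duplicate, so a step with a rule l' -> r' changes the weight of the term
   by at most weight r' - weight l'. For match(R) this replaces a symbol of some
   height m < c by symbols of height m + 1 (m < c because r' is not a variable
   and the reduct has heights at most c); a MATCHRT^c(S) step either does the
   same or has no effect on the weight, because it introduces symbols of height
   c, or no more symbols, of the same height, than it removes. The indicators
   of h <= k, for k < c,
   give lexicographic termination. If right-hand sides have at most M symbols,
   the weights with w m = M * w (m + 1) + 1 decrease in every R/S-step, and the
   initial weight is at most w 0 times the size of the start term.
   Steps on base terms lift to F_N, since any two terms with equal base have a
   common raise reduct. *)
Require Import Defs.
From Stdlib Require Import Relations.
From mathcomp Require Import all_boot zify.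
From mathcomp Require Import boolp classical_sets functions cardinality.

Set Implicit Arguments.
Unset Strict Implicit.
Unset Printing Implicit Defensive.

Local Open Scope classical_set_scope.

(** * Terms *)

Section TermTheory.
Variables F G : Type.
Implicit Types (t u : term F) (ts us : seq (term F)).

(** The conjunction over [ts] supplies a hypothesis for every argument; a further induction on [ts]
    peels off both together. *)
Lemma term_nested_ind (P : term F -> Prop) :
  (forall x, P (Var x)) ->
  (forall f ts, foldr (fun u => and (P u)) True ts -> P (App f ts)) ->
  forall t, P t.
Proof.
move=> PV PA; fix IH 1 => -[x|f ts]; first exact: PV.
by apply: PA; elim: ts => //= u ts IHts; split.
Qed.

Lemma subst_ext (s1 s2 : nat -> term F) t :
  (forall x, x \in vars t -> s1 x = s2 x) -> subst s1 t = subst s2 t.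
Proof.
elim/term_nested_ind: t => [x|f ts] /=; first by apply; rewrite inE.
move=> IH eq_s; congr App; elim: ts IH eq_s => //= u ts IHts [IHu IH] eq_s.
by rewrite IHu ?IHts // => x xP; apply: eq_s; rewrite mem_cat xP ?orbT.
Qed.

Lemma vars_map_sym (g : F -> G) t : vars (map_sym g t) = vars t.
Proof.
elim/term_nested_ind: t => //= _ ts; elim: ts => //= u ts IH [-> /IH].
by move=> ->.
Qed.

Lemma map_symK (g : F -> G) (h : G -> F) t :
  cancel g h -> map_sym h (map_sym g t) = t.
Proof.
move=> gK; elim/term_nested_ind: t => //= f ts IH; rewrite gK; congr App.
by elim: ts IH => //= u ts IHts [-> /IHts ->].
Qed.

Lemma map_sym_subst (g : F -> G) s t :
  map_sym g (subst s t) = subst (map_sym g \o s) (map_sym g t).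
Proof.
elim/term_nested_ind: t => //= f ts IH; congr App.
by elim: ts IH => //= u ts IHts [-> /IHts ->].
Qed.

Lemma subterm_at_map_sym (g : F -> G) t p :
  subterm_at (map_sym g t) p = omap (map_sym g) (subterm_at t p).
Proof.
elim: p t => [|i p IH] [x|f ts] //=; rewrite onth_map.
by case: (onth ts i) => //= u; rewrite IH.
Qed.

(** Splitting the argument list around index [i] turns replacement below it into concatenation, as
    the inductions on positions need. *)
Lemma subterm_at_consP t i p v : subterm_at t (i :: p) = Some v ->
  exists f ts1 u ts2,
    [/\ t = App f (ts1 ++ u :: ts2), size ts1 = i & subterm_at u p = Some v].
Proof.
case: t => //= f ts; case def_u: (onth ts i) => [u|] //= up.
have lt_i : i < size ts by rewrite -onthTE def_u.
exists f, (take i ts), u, (drop i.+1 ts); rewrite size_takel ?(ltnW lt_i) //.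
by split=> //; rewrite -(onth_nth u _ _ _ def_u) -drop_nth ?cat_take_drop.
Qed.

Lemma replace_at_cons f ts1 u ts2 p v :
  replace_at (App f (ts1 ++ u :: ts2)) (size ts1 :: p) v =
  App f (ts1 ++ replace_at u p v :: ts2).
Proof.
rewrite /= nth_cat ltnn subnn /= set_nthE size_cat /= -addn1 leq_add2l /=.
by rewrite take_size_cat // addn1 -(cat_rcons u) drop_size_cat ?size_rcons.
Qed.

Lemma subterm_at_cons f ts1 u ts2 p :
  subterm_at (App f (ts1 ++ u :: ts2)) (size ts1 :: p) = subterm_at u p.
Proof. by rewrite /= onth_cat ltnn subnn. Qed.

Lemma subterm_at_replace t p u v :
  subterm_at t p = Some v -> subterm_at (replace_at t p u) p = Some u.
Proof.
elim: p t => [|i p IH] t; first by case: t.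
move=> /subterm_at_consP [f [ts1 [w [ts2 [-> <- /IH wp]]]]].
by rewrite replace_at_cons subterm_at_cons.
Qed.

Lemma replace_at_self t p v : subterm_at t p = Some v -> replace_at t p v = t.
Proof.
elim: p t => [|i p IH] t; first by case: t => [x|f ts] [<-].
move=> /subterm_at_consP [f [ts1 [w [ts2 [-> <- /IH wp]]]]].
by rewrite replace_at_cons wp.
Qed.

Lemma fpos_arg k (ss : seq (seq (seq nat))) i p :
  ((i :: p) \in flatten [seq [seq ip.1 :: q | q <- ip.2]
                       | ip <- zip (iota k (size ss)) ss])
  = [&& k <= i, i < k + size ss & p \in nth [::] ss (i - k)].
Proof.
elim: ss k => [|s ss IH] k /=; first by case: (i - k) => *; rewrite !andbF.
rewrite mem_cat IH; case: (ltngtP k i) => [lt_ki|lt_ik|<-].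
- rewrite addSnnS -[i - k]prednK ?subn_gt0 // -subnS /=.
  by case: mapP => // -[q _ [eq_ik]]; rewrite eq_ik ltnn in lt_ki.
- by case: mapP => // -[q _ [eq_ik]]; rewrite eq_ik ltnn in lt_ik.
rewrite subnn orbF -[k in k < _]addn0 ltn_add2l /=.
by rewrite mem_map // => q1 q2 [].
Qed.

Lemma mem_fpos t p :
  (p \in fpos t) = if subterm_at t p is Some (App _ _) then true else false.
Proof.
elim: p t => [|i p IH] [x|f ts] //=; rewrite inE /=.
rewrite -[in iota _ _](size_map (@fpos F)) fpos_arg /= size_map subn0.
rewrite add0n -onthTE; case def_u: (onth ts i) => [u|] //=.
have lt_i : i < size ts by rewrite -onthTE def_u.
by rewrite (nth_map u) // (onth_nth u _ _ _ def_u) IH.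
Qed.

End TermTheory.

Lemma vars_subst (V : Type) (sg : nat -> term V) (t : term V) :
  vars (subst sg t) = flatten [seq vars (sg x) | x <- vars t].
Proof.
elim/term_nested_ind: t => [x|f ts] /=; first by rewrite cats0.
by elim: ts => //= u ts IHts [-> /IHts ->]; rewrite map_cat flatten_cat.
Qed.

Lemma fpos_map_sym (A B : Type) (g : A -> B) (t : term A) :
  fpos (map_sym g t) =i fpos t.
Proof.
by move=> p; rewrite !mem_fpos subterm_at_map_sym; case: subterm_at => // -[].
Qed.

Lemma subst_nth_catl (V : Type) (ts1 ts2 : seq (term V)) k C :
  vars C = iota k (size ts1) ->
  subst (fun i => nth (Var 0) (ts1 ++ ts2) (i - k)) C =
  subst (fun i => nth (Var 0) ts1 (i - k)) C.
Proof.
move=> vC; apply: subst_ext => i; rewrite vC mem_iota => /andP [le_ki lt_i].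
by rewrite nth_cat ltn_subLR ?lt_i.
Qed.

Lemma subst_nth_catr (V W : Type) (g : term V -> W)
    (ts1 ts2 : seq (term V)) k Cs :
  all (leq (k + size ts1)) (flatten (map (@vars V) Cs)) ->
  [seq g (subst (fun i => nth (Var 0) (ts1 ++ ts2) (i - k)) C) | C <- Cs] =
  [seq g (subst (fun i => nth (Var 0) ts2 (i - (k + size ts1))) C) | C <- Cs].
Proof.
elim: Cs => //= C Cs IH; rewrite all_cat => /andP [/allP vC /IH ->].
congr (g _ :: _); apply: subst_ext => i /vC le_i.
by rewrite nth_cat subnDA ltnNge leq_subRL ?le_i // (leq_trans (leq_addr _ _) le_i).
Qed.

Lemma base_lift (V : Type) d (t : term V) : base (lift_term d t) = t.
Proof. exact: map_symK. Qed.

Lemma map_sym_replace (F G : Type) (g : F -> G) t p u v :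
  subterm_at t p = Some v ->
  map_sym g (replace_at t p u) = replace_at (map_sym g t) p (map_sym g u).
Proof.
elim: p t => [|i p IH] t; first by case: t.
move=> /subterm_at_consP [f [ts1 [w [ts2 [-> <- /IH wp]]]]].
have eq_arg x : map_sym g (App f (ts1 ++ x :: ts2)) =
    App (g f) (map (map_sym g) ts1 ++ map_sym g x :: map (map_sym g) ts2).
  by rewrite /= map_cat.
by rewrite replace_at_cons !eq_arg -(size_map (map_sym g)) replace_at_cons wp.
Qed.

(** * Reachability and weights *)

Section Star.
Variables (T : Type) (Rel : relation T).

Lemma star_map (f : T -> T) s t :
  (forall x y, Rel x y -> Rel (f x) (f y)) ->
  star Rel s t -> star Rel (f s) (f t).
Proof.
move=> fRel; elim=> [x y xy|x|x y z _ xy _ yz].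
- exact/rt_step/fRel.
- exact: rt_refl.
- exact: rt_trans xy yz.
Qed.

Lemma star_rpow s t : star Rel s t -> exists m, rpow Rel m s t.
Proof.
move=> st; elim: (clos_rt_rt1n _ _ _ _ st) => [x|x y z xy _ [m yz]].
  by exists 0.
by exists m.+1, y.
Qed.

End Star.

Section Weight.
Variable F : Type.
Implicit Types (t u : term (F * nat)) (w : nat -> nat).

Fixpoint weight w t : nat :=
  match t with
  | Var _ => 0
  | App f ts => w f.2 + sumn [seq weight w u | u <- ts]
  end.

Lemma weight_subst w s t :
  weight w (subst s t) = weight w t + sumn [seq weight w (s x) | x <- vars t].
Proof.
elim/term_nested_ind: t => [x|f ts] /=; first by rewrite addn0.
move=> IH; rewrite -addnA; congr addn; elim: ts IH => //= u ts IHts [-> /IHts ->].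
by rewrite map_cat sumn_cat addnACA.
Qed.

Lemma weight_lift w d (t : term F) :
  weight w (lift_term d t) = fun_size t * w d.
Proof.
elim/term_nested_ind: t => //= f ts IH; rewrite mulSn; congr addn.
by elim: ts IH => //= u ts IHts [-> /IHts ->]; rewrite mulnDl.
Qed.

Lemma weight_replace w t p u v : subterm_at t p = Some v ->
  weight w (replace_at t p u) + weight w v = weight w t + weight w u.
Proof.
elim: p t => [|i p IH] t; first by case: t => [x|f ts] [<-]; rewrite addnC.
move=> /subterm_at_consP [f [ts1 [x [ts2 [-> <- /IH xp]]]]].
rewrite replace_at_cons /= !map_cat !sumn_cat /=; lia.
Qed.

Lemma weight_height w t p : p \in fpos t -> w (height_at t p) <= weight w t.
Proof.
rewrite mem_fpos /height_at.
case def_u: (subterm_at t p) => [[x|f ts]|] // _.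
(* Replacing the subterm by a variable, of weight 0, isolates the contribution of its root
   symbol. *)
have := weight_replace w (Var 0) def_u; rewrite /= addn0 => <-.
by rewrite addnCA leq_addr.
Qed.

End Weight.

Lemma sumn_map_le_zip (I J : Type) (f : I -> nat) (g : J -> nat) xs ys :
  size xs = size ys -> all (fun xy => f xy.1 <= g xy.2) (zip xs ys) ->
  sumn (map f xs) <= sumn (map g ys).
Proof.
elim: xs ys => [|x xs IH] [|y ys] //= [/IH le_s] /andP [le_xy /le_s].
exact: leq_add.
Qed.

Lemma sumn_map_sub (I : eqType) (f : I -> nat) (s1 s2 : seq I) :
  (forall x, count_mem x s1 <= count_mem x s2) ->
  sumn [seq f x | x <- s1] <= sumn [seq f x | x <- s2].
Proof.
(* Domination of multiplicities makes [s1] a permutation of a subsequence [s] of [s2]. *)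
move=> /count_subseqP [s sub /(perm_map f) /perm_sumn ->].
elim: s2 s sub => [|y s2 IH] [|x s] //= sub.
move: sub; case: eqP => [->|_] /IH; rewrite ?leq_add2l //= => /leq_trans -> //.
by rewrite leq_addl.
Qed.

Lemma bigmin_in (I : eqType) (s : seq I) (f : I -> nat) x :
  \big[minn/x]_(i <- s) f i = x \/
  exists2 i, i \in s & \big[minn/x]_(i <- s) f i = f i.
Proof.
elim: s => [|y s IH]; first by left; rewrite big_nil.
rewrite big_cons; case: leqP => _.
  by right; exists y; rewrite ?inE ?eqxx.
by case: IH => [->|[i si ->]]; [left|right; exists i; rewrite // inE si orbT].
Qed.

(** Only components below [c] count. The choice [m = c] expresses weak decrease of all of them, so
    that steps without strict progress compose with the others. *)
Definition lexdrop c m (a b : nat -> nat) : Prop :=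
  (forall k, k < m -> a k <= b k) /\ (m < c -> a m < b m).

Lemma lexdrop_trans c m1 m2 a1 a2 a3 :
  lexdrop c m1 a1 a2 -> lexdrop c m2 a2 a3 -> lexdrop c (minn m1 m2) a1 a3.
Proof.
move=> [le1 lt1] [le2 lt2]; split=> [k|].
  by rewrite leq_min => /andP [/le1 le12 /le2]; apply: leq_trans.
case: (ltngtP m1 m2) => [lt12 /lt1 lt_c|lt21 /lt2|eq_m lt_mc].
- exact: leq_trans lt_c (le2 _ lt12).
- exact/leq_ltn_trans/le1.
- by apply: ltn_trans (lt1 lt_mc) _; rewrite eq_m lt2 -?eq_m.
Qed.

Definition lexlt c (a b : nat -> nat) := exists2 m, m < c & lexdrop c m a b.

(** Induction on the number of components: an outer induction on a bound for component 0, an inner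
    one on the other components, shifted down by one. *)
Lemma lexlt_wf c : well_founded (lexlt c).
Proof.
elim: c => [|c IH] b; first by constructor=> a [].
have [n] := ubnP (b 0); elim: n b => [|n IHn] b lt_b; first by clear IH.
move def_g: (b \o succn) => g.
elim: {g}(IH g) b def_g lt_b => g _ IHg b def_g lt_b.
constructor=> a [[|m] lt_m [le_ab lt_ab]].
  (* For drop index 0 the outer induction applies; otherwise component 0 does not grow and the
     shifted tail drops. *)
  by apply: IHn; apply: leq_trans (lt_ab _) _.
apply: IHg erefl _; last exact: leq_ltn_trans (le_ab 0 _) lt_b.
by exists m; rewrite // -def_g; split=> [k lt_k|lt_mc]; [exact: le_ab | exact: lt_ab].
Qed.

Lemma ele_esup (A : set enat) b : (forall a, A a -> ele a (Some b)) ->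
  ele (esup A) (Some b).
Proof.
move=> ub; rewrite /esup; case: pselect => [ex_b|no_b].
  by case: ex_minnP => m _; apply; apply/asboolP.
by case: no_b; exists b; apply/asboolP.
Qed.

(** Supplies the constant [M] from which the weights of the linear bound are built. *)
Lemma finite_rules_bounded (F : Type) (T : rules F) : finite_set T ->
  exists M, forall l r, T (l, r) -> fun_size r <= M.
Proof.
move=> /(finite_image (fun rho => fun_size rho.2)) /finite_seqP [s def_s].
exists (\max_(n <- s) n) => l r Tlr.
have : [set fun_size rho.2 | rho in T] (fun_size r) by exists (l, r).
by rewrite def_s => /= rs; rewrite (big_rem _ rs) leq_maxl.
Qed.

Lemma rstep_arg (F : Type) (T : rules F) f ts1 t u ts2 : rstep T t u ->
  rstep T (App f (ts1 ++ t :: ts2)) (App f (ts1 ++ u :: ts2)).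
Proof.
move=> [l [r [p [s [Tlr tp ->]]]]]; exists l, r, (size ts1 :: p), s.
by split=> //; rewrite ?subterm_at_cons ?replace_at_cons.
Qed.

(** * Well-formed ground terms *)

Section WellFormed.
Variable F : signature.
Implicit Types (t u : term F).

Fixpoint gwf t : bool :=
  match t with
  | Var _ => false
  | App f ts => (size ts == arity f) && all gwf ts
  end.

Lemma gwf_subst s t : gwf (subst s t) = wf t && all (gwf \o s) (vars t).
Proof.
elim/term_nested_ind: t => [x|f ts] /=; first by rewrite andbT.
move=> IH; rewrite size_map -andbA; congr andb.
elim: ts IH => //= u ts IHts [-> /IHts ->].
by rewrite all_cat -!andbA; congr andb; rewrite andbCA.
Qed.

Lemma gwfE t : gwf t = wf t && (vars t == [::]).
Proof.
elim/term_nested_ind: t => [x|f ts] //= IH; rewrite -andbA; congr andb.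
elim: ts IH => //= u ts IHts [-> /IHts ->].
by rewrite -!nilpE cat_nilp -!andbA; congr andb; rewrite andbCA.
Qed.

Lemma gwf_subterm t p v : gwf t -> subterm_at t p = Some v -> gwf v.
Proof.
elim: p t => [|i p IH] t; first by case: t => [x|f ts] // gt [<-].
move=> gt /subterm_at_consP [f [ts1 [u [ts2 [def_t _ up]]]]].
move: gt; rewrite def_t /= all_cat /= => /and4P [_ _ gu _].
exact: IH up.
Qed.

Lemma gwf_replace t p u v :
  gwf t -> subterm_at t p = Some v -> gwf u -> gwf (replace_at t p u).
Proof.
elim: p t => [|i p IH] t; first by case: t.
move=> gt /subterm_at_consP [f [ts1 [x [ts2 [def_t <- xp]]]]] gu.
move: gt; rewrite def_t replace_at_cons /= !all_cat !size_cat /=.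
by case/and4P=> -> -> gx ->; rewrite (IH x).
Qed.

Lemma gwf_rstep (T : rules F) t u :
  is_TRS T -> rstep T t u -> gwf t -> gwf u.
Proof.
move=> trsT [l [r [p [s [/trsT [wl wr _ sub_rl] tp ->]]]]] gt.
apply: (gwf_replace gt tp); move: (gwf_subterm gt tp).
rewrite !gwf_subst wl wr => /allP gs; apply/allP => x /sub_rl; exact: gs.
Qed.

Lemma fun_size_le_term_size t : fun_size t <= term_size t.
Proof.
elim/term_nested_ind: t => [x|f ts] //= IH; rewrite ltnS.
by elim: ts IH => //= u ts IHts [? /IHts ?]; apply: leq_add.
Qed.

End WellFormed.

(** * Raising and joins *)

Section Raise.
Variable F : signature.
Implicit Types (s t u : term (F * nat)).
Local Notation raise := (rstep (@raise_rules F)).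

Lemma raise_base s t : raise s t -> base t = base s.
Proof.
move=> [_ [_ [p [sg [[f [c [-> ->]]] sp ->]]]]].
(* Both sides of a raise rule have the same base, so on base terms a subterm is replaced by
   itself. *)
rewrite /base (map_sym_replace _ _ sp); apply: (replace_at_self (v := _)).
by rewrite subterm_at_map_sym sp.
Qed.

Lemma raise_weight w s t : {homo w : i j /~ i <= j} ->
  raise s t -> weight w t <= weight w s.
Proof.
move=> wN [_ [_ [p [sg [[f [c [-> ->]]] sp ->]]]]].
have := weight_replace w (subst sg (App (f, c.+1) (map Var (iota 0 (arity f))))) sp.
rewrite !weight_subst /=; have := wN _ _ (leqnSn c); lia.
Qed.

Lemma rpow_raise_base m s t : rpow raise m s t -> base t = base s.
Proof. by elim: m s => [|m IH] s /= => [->|[u /raise_base <- /IH]]. Qed.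

Lemma rpow_raise_weight w m s t : {homo w : i j /~ i <= j} ->
  rpow raise m s t -> weight w t <= weight w s.
Proof.
move=> wN; elim: m s => [|m IH] s /=; first by move->.
by move=> [u /(raise_weight wN) le_us /IH le_tu]; apply: leq_trans le_us.
Qed.

Lemma raise_root (f : F) c d ts : size ts = arity f -> c <= d ->
  star raise (App (f, c) ts) (App (f, d) ts).
Proof.
move=> szt; elim: d => [|d IH]; first by rewrite leqn0 => /eqP->; apply: rt_refl.
rewrite leq_eqVlt ltnS => /orP [/eqP<-|/IH le_cd]; first exact: rt_refl.
apply: rt_trans le_cd (rt_step _ _ _ _ _).
have eq_ts : [seq subst (nth (Var 0) ts) u | u <- map Var (iota 0 (arity f))] = ts.
  by rewrite -map_comp -szt map_nth_iota0 // take_size.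
exists (App (f, d) (map Var (iota 0 (arity f)))).
exists (App (f, d.+1) (map Var (iota 0 (arity f)))), [::], (nth (Var 0) ts).
by rewrite /= eq_ts; split=> //; exists f, d.
Qed.

Lemma raise_lift s : gwf (base s) ->
  exists N, forall d, N <= d -> star raise s (lift_term d (base s)).
Proof.
elim/term_nested_ind: s => // -[f c] ts IH /=.
rewrite size_map => /andP [/eqP szt gts].
(* The arguments are raised from left to right, [ts1] being those already treated; the root follows
   at the end. *)
have [N raise_args] : exists N, forall d, N <= d -> forall ts1,
    star raise (App (f, c) (ts1 ++ ts))
               (App (f, c) (ts1 ++ [seq lift_term d (base u) | u <- ts])).
  elim: ts IH gts {szt} => [_ _|u ts IHts /= [IHu /IHts IH] /andP [/IHu + /IH]].
    by exists 0 => d _ ts1; apply: rt_refl.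
  move=> [N1 N1P] [N2 N2P]; exists (maxn N1 N2) => d; rewrite geq_max.
  case/andP=> /N1P ru /N2P rts ts1.
  apply: rt_trans (_ : star _ _ (App (f, c) (ts1 ++ lift_term d (base u) :: ts))) _.
    pose C x := App (f, c) (ts1 ++ x :: ts).
    by apply: (star_map (f := C)) ru => x y; apply: rstep_arg.
  by rewrite -!cat_rcons; apply: rts.
exists (maxn N c) => d; rewrite geq_max => /andP [/raise_args/(_ [::]) rts le_cd].
apply: rt_trans rts _; rewrite /lift_term /= -map_comp.
by apply: raise_root; rewrite // size_map.
Qed.

(** Both terms can be raised to one uniform lifting of their common base; among all joins, one of
    least total length is chosen. *)
Lemma join_exists s t : gwf (base s) -> base t = base s ->
  exists u, is_join s t u.
Proof.
move=> gs eq_ts; have [N1 N1P] := raise_lift gs.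
have [N2] : exists N, forall d, N <= d -> star raise t (lift_term d (base t)).
  by apply: raise_lift; rewrite eq_ts.
rewrite eq_ts => N2P; pose d := maxn N1 N2.
pose P k := `[< exists m n u, [/\ k = m + n, rpow raise m s u & rpow raise n t u] >].
have exP : exists k, P k.
  have [m sm] := star_rpow (N1P d (leq_maxl _ _)).
  have [n tn] := star_rpow (N2P d (leq_maxr _ _)).
  by exists (m + n); apply/asboolP; exists m, n, (lift_term d (base s)).
case: (ex_minnP exP) => k /asboolP [m [n [u [-> sm tn]]]] min_k.
exists u, m, n; split=> // u' m' n' sm' tn'; apply: min_k.
by apply/asboolP; exists m', n', u'.
Qed.

Lemma joins_exist b ss : gwf b -> ~~ nilp ss ->
  all (fun s => `[< base s = b >]) ss -> exists2 u, is_joins ss u & base u = b.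
Proof.
move=> gb; elim: ss => // s [|t ss] IH _ /= /andP [/asboolP sb tsb].
  by exists s.
have [v vjoin vb] := IH isT tsb; have [u uj] : exists u, is_join s v u.
  by apply: join_exists; rewrite sb.
exists u; first by exists v.
by have [m [_ [/rpow_raise_base -> _ _]]] := uj.
Qed.

Lemma joins_weight w ss u : {homo w : i j /~ i <= j} ->
  is_joins ss u -> all (fun s => weight w u <= weight w s) ss.
Proof.
move=> wN; elim: ss u => [|s [|t ss] IH] u //; first by move=> ->; rewrite /= leqnn.
move=> [v /IH vle [m [n [su vu _]]]]; apply/andP; split.
  exact: rpow_raise_weight su.
by apply: sub_all vle => x; apply: leq_trans; apply: rpow_raise_weight vu.
Qed.

End Raise.

(** * Weight change of raise steps *)

Section RaiseStep.
Variable F : signature.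
Implicit Types (s t u : term (F * nat)) (T : rules (F * nat)).

(** The substituted terms never gain weight, so only the rule itself can. The occurrence of the
    contractum in [t] is returned too, since heights in [t] must later be read off there. *)
Lemma raise_step_weight T s t : raise_step T s t ->
  exists l r p sg, [/\ T (l, r), subterm_at t p = Some (subst sg r) &
    (forall x, count_mem x (vars r) <= count_mem x (vars l)) ->
    forall w, {homo w : i j /~ i <= j} ->
      weight w t + weight w l <= weight w s + weight w r].
Proof.
move=> [l [r [p [C [xs [ss [sg [Tlr [varsC szs] [def_l sp] _ [joins ->]]]]]]]]].
exists l, r, p, sg; split=> // [|rl w wN]; first exact: subterm_at_replace sp.
have varsCs (V : Type) (f : term (F * nat) -> V) us : size us = size xs ->
    [seq f (nth (Var 0) us i) | i <- vars C] = map f us.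
  by move=> szu; rewrite varsC -szu (map_comp f) -[map (nth _ _) _]/(mkseq _ _) mkseq_nth.
have varsl : vars l = xs.
  rewrite def_l vars_subst varsCs ?size_map // -map_comp /=.
  by elim: (xs) => //= x xs' ->.
have wl : weight w l = weight w C.
  rewrite def_l weight_subst varsCs ?size_map // -map_comp /=.
  by rewrite (_ : sumn _ = 0) ?addn0 //; elim: (xs).
have := weight_replace w (subst sg r) sp.
rewrite !weight_subst varsCs // -wl.
pose W (x : nat) := weight w (sg x); rewrite -/W.
(* Non-duplication: the multiset of variables of [r] is contained in that of [l]. *)
have le_r : sumn (@map nat nat W (vars r)) <= sumn (@map nat nat W xs).
  by apply: sumn_map_sub; rewrite -varsl.
suff : sumn (@map nat nat W xs) <= sumn (map (weight w) ss).
  move: le_r; lia.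
(* Each [sg x] is a join of the terms at the holes of [x], hence no heavier than any of them. *)
apply: sumn_map_le_zip; first by rewrite szs.
apply/(all_nthP (0, Var 0)) => i; rewrite size_zip szs minnn => lt_i.
rewrite nth_zip //=; set x := nth 0 xs i.
have x_xs : x \in xs by apply: mem_nth.
have := joins x; rewrite x_xs => /(joins_weight wN).
rewrite all_map all_filter => /(all_nthP (0, Var 0)) /(_ i).
by rewrite size_zip szs minnn lt_i nth_zip //= eqxx; apply.
Qed.

(* A step that trades a symbol of height m < c for at most K symbols of height
   m + 1, or, for m >= c, one that does not increase the weight. *)
Definition descends c K m s t := forall w, {homo w : i j /~ i <= j} -> w c = 0 ->
  weight w t + w m <= weight w s + K * w m.+1.

Lemma match_step_descends c (R : rules F) s t :
  is_TRS R -> non_duplicating R -> ~ collapsing R ->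
  (forall p, p \in fpos t -> height_at t p <= c) ->
  raise_step (match_rules R) s t ->
  exists l r m, [/\ R (l, r), m < c & descends c (fun_size r) m s t].
Proof.
move=> trsR ndR ncR ht /raise_step_weight [l' [r' [p [sg [Tlr tp weights]]]]].
case: Tlr => l [r [l'' [Rlr base_l [eq_l' def_r']]]].
subst l'' r'.
(* [q] attains the minimum; if this is the initial value, the root serves, since [l] is not a
   variable. *)
have [q ql def_m] : exists2 q, q \in fpos l' &
  \big[minn/height_at l' [::]]_(p <- fpos l) height_at l' p = height_at l' q.
  have [->|[q ql ->]] := bigmin_in (fpos l) (height_at l') (height_at l' [::]).
    exists [::] => //; rewrite -(fpos_map_sym fst) -/(base l') base_l.
    by have [_ _ + _] := trsR _ _ Rlr; case: (l) => // x /(_ x).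
  by exists q; rewrite // -(fpos_map_sym fst) -/(base l') base_l.
rewrite {}def_m in tp weights; set m := height_at l' q in tp weights.
exists l, r, m; split=> //.
  (* As [r] is not a variable, position [p] of [t] carries a symbol of height [m.+1], which is at
     most [c]. *)
  have pt : p \in fpos t.
    rewrite mem_fpos tp; case: (r) Rlr => // x Rlx.
    by case: ncR; exists l, x.
  move: (ht p pt); rewrite /height_at tp; case: (r) Rlr => // x Rlx.
  by case: ncR; exists l, x.
move=> w wN wc; have := weight_height w ql; rewrite -/m.
have := weights _ w wN; rewrite weight_lift.
suff nd x : count_mem x (vars (lift_term m.+1 r)) <= count_mem x (vars l').
  by move=> /(_ nd); lia.
by rewrite -(vars_map_sym fst l') -/(base l') base_l vars_map_sym ndR.
Qed.

(** Steps without progress are recorded with [m = c], where the weight vanishes; no height bound on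
    [t] is required. *)
Lemma matchRT_step_descends c (S : rules F) s t :
  is_TRS S -> non_duplicating S -> raise_step (matchRT_rules c S) s t ->
  exists l r m, [/\ S (l, r), m <= c & descends c (fun_size r) m s t].
Proof.
move=> trsS ndS /raise_step_weight [l' [r' [p [sg [Tlr _ weights]]]]].
case: Tlr => l'' [r []]; set h := height_at _ _.
set d := if _ then _ else _ => Slr [eq_l' def_r']; subst l'' r'.
have {}weights w : {homo w : i j /~ i <= j} ->
    weight w t + weight w l' <= weight w s + fun_size r * w d.
  move=> wN; rewrite -weight_lift; apply: weights => // x.
  by rewrite (vars_map_sym _ r) -(vars_map_sym fst l') ndS.
have w0 w i : {homo w : i j /~ i <= j} -> w c = 0 -> c <= i -> w i = 0.
  by move=> wN wc /wN; rewrite wc leqn0 => /eqP.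
have weak : (forall w, {homo w : i j /~ i <= j} -> w c = 0 ->
    fun_size r * w d <= weight w l') ->
    exists l r0 m, [/\ S (l, r0), m <= c & descends c (fun_size r0) m s t].
  move=> le_r; exists (base l'), r, c; split=> // w wN wc.
  by have := weights w wN; have := le_r w wN wc; lia.
(* If the rule keeps the height of a uniform left-hand side, or introduces height [c] or more, its
   right-hand side is no heavier. Otherwise the minimum is attained at some [q] of height below
   [c]. *)
move: @d weights weak; case: asboolP => [[le_rl eq_l']|_] d weights weak.
  apply: weak => w wN wc; rewrite -eq_l' weight_lift; apply: leq_mul => //.
  by rewrite /d; case: (leqP c h) => // _; rewrite wc.
have [def_d|[q ql def_d]] := bigmin_in (fpos l') (fun p => (height_at l' p).+1) c.
  by apply: weak => w wN wc; rewrite /d def_d wc muln0.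
have [le_cq|lt_qc] := leqP c (height_at l' q).
  by apply: weak => w wN wc; rewrite /d def_d (w0 w) ?muln0 // leqW.
exists (base l'), r, (height_at l' q); split=> //; first exact: ltnW.
move=> w wN _; have := weight_height w ql; have := weights w wN.
by rewrite /d def_d; lia.
Qed.
End RaiseStep.

(** * Lifting steps to labelled terms *)

Section Simulation.
Variable F : signature.
Implicit Types (R S : rules F) (T : rules (F * nat)).

(* The context of l common to u is produced together with the arguments ss at the
   holes; the hole numbers start from k to make the induction go through. *)
Lemma split_instance (l : term F) sg u k : base u = subst sg l ->
  exists C ss, [/\ vars C = iota k (size (vars l)),
    base (subst (fun i => nth (Var 0) (map Var (vars l)) (i - k)) C) = l,
    u = subst (fun i => nth (Var 0) ss (i - k)) C &
    map (@base F) ss = map sg (vars l)].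
Proof.
elim/term_nested_ind: l k u => [x|f ts IH] k u.
  by exists (Var k), [:: u]; split; rewrite //= ?subnn //; congr [:: _].
case: u => [y|[g d] us] //= [-> eq_us]; set vts := flatten _.
suff [Cs [ss [varsCs eq_ts -> eq_ss]]] : exists Cs ss,
    [/\ flatten (map (@vars _) Cs) = iota k (size vts),
      [seq base (subst (fun i => nth (Var 0) (map Var vts) (i - k)) C) | C <- Cs]
        = ts,
      us = [seq subst (fun i => nth (Var 0) ss (i - k)) C | C <- Cs] &
      map (@base F) ss = map sg vts].
  exists (App (f, d) Cs), ss; split=> //=; congr App.
  by rewrite -map_comp -[RHS]eq_ts.
rewrite {}/vts; elim: ts us eq_us k IH => [|t ts IHts] [|u us] //= => [_ k _|].
  by exists [::], [::].
move=> [eq_u /IHts {}IHts] k [/(_ k _ eq_u) [C [s1 [vC eq_t def_u eq_s1]]]].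
(* The holes of the remaining arguments are numbered after those of the first. *)
move=> /(IHts (k + size (vars t))) [Cs [s2 [vCs eq_ts def_us eq_s2]]].
have sz1 : size s1 = size (vars t) by rewrite -(size_map (@base F)) eq_s1 size_map.
have vCs_ge (ts1 : seq (term (F * nat))) : size ts1 = size (vars t) ->
    all (leq (k + size ts1)) (flatten (map (@vars _) Cs)).
  by rewrite vCs => ->; apply/allP => i; rewrite mem_iota => /andP [].
exists (C :: Cs), (s1 ++ s2).
rewrite /= vC vCs size_cat iotaD !map_cat eq_s1 eq_s2; split=> //.
  rewrite subst_nth_catl ?size_map // eq_t subst_nth_catr ?vCs_ge ?size_map //.
  by congr cons.
rewrite subst_nth_catl ?sz1 // -def_u (subst_nth_catr (fun v => v)) ?vCs_ge //.
by rewrite sz1 -def_us.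
Qed.

(** Left-linearity is not assumed: the arguments at equal variables agree only up to base, and their
    join repairs the mismatch in heights. *)
Lemma raise_step_sim (T0 : rules F) T s t : is_TRS T0 ->
  (forall l r l', T0 (l, r) -> base l' = l -> exists d, T (l', lift_term d r)) ->
  gwf (base s) -> rstep T0 (base s) t ->
  exists2 t', raise_step T s t' & base t' = t.
Proof.
move=> trsT0 liftT gs [l [r [p [sg [T0lr sp ->]]]]].
have := gwf_subterm gs sp; rewrite gwf_subst => /andP [_ gsg].
move: sp; rewrite subterm_at_map_sym.
case sp: (subterm_at s p) => [u|] //= [/(split_instance 0) [C [ss]]].
set xs := vars l => -[vC base_l def_u base_ss].
have szs : size ss = size xs by rewrite -(size_map (@base F)) base_ss size_map.
have base_nth i : i < size xs -> base (nth (Var 0) ss i) = sg (nth 0 xs i).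
  move=> lt_i; rewrite -(nth_map (Var 0) (Var 0)) ?szs // base_ss.
  by rewrite (nth_map 0).
(* The specification of the substitution in a raise step, together with the base needed to recover
   [t]. *)
pose joinP x v := if x \in xs
  then is_joins [seq xi.2 | xi <- zip xs ss & xi.1 == x] v /\ base v = sg x
  else v = Var x.
have [tau tauP] : {tau : nat -> term (F * nat) & forall x, joinP x (tau x)}.
  apply: choice => x; rewrite /joinP; case x_xs: (x \in xs); last by exists (Var x).
  have [||| v] := @joins_exist F (sg x) [seq xi.2 | xi <- zip xs ss & xi.1 == x].
  - exact: (allP gsg).
  - rewrite /nilp size_map size_filter -lt0n -has_count.
    apply/(has_nthP (0, Var 0)); exists (index x xs).
      by rewrite size_zip szs minnn index_mem.
    by rewrite nth_zip //= nth_index.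
  - rewrite all_map all_filter; apply/(all_nthP (0, Var 0)) => i.
    rewrite size_zip szs minnn => lt_i; rewrite nth_zip //=.
    by apply/implyP => /eqP <-; apply/asboolP/base_nth.
  by move=> *; exists v.
have Cfill (us : seq (term (F * nat))) :
    subst (fun i => nth (Var 0) us (i - 0)) C = fill C us.
  by apply: subst_ext => i _; rewrite subn0.
rewrite Cfill in def_u; rewrite Cfill in base_l.
have [d Tl] := liftT l r _ T0lr base_l.
exists (replace_at s p (subst tau (lift_term d r))).
  exists (fill C (map Var xs)), (lift_term d r), p, C, xs, ss, tau.
  split=> //; first by rewrite -def_u.
    by move=> i j lt_i lt_j eq_ij; rewrite !base_nth ?eq_ij.
  by split=> // x; have := tauP x; rewrite /joinP; case: ifP => // _ [].
rewrite /base (map_sym_replace _ _ sp) map_sym_subst -/(base s).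
rewrite map_symK //; congr replace_at; apply: subst_ext => x xr /=.
have [_ _ _ /(_ x xr) xl] := trsT0 _ _ T0lr.
by have := tauP x; rewrite /joinP xl => -[].
Qed.

Lemma star_raise_step_sim (T0 : rules F) T s t : is_TRS T0 ->
  (forall l r l', T0 (l, r) -> base l' = l -> exists d, T (l', lift_term d r)) ->
  gwf (base s) -> star (rstep T0) (base s) t ->
  exists t', [/\ star (raise_step T) s t', base t' = t & gwf t].
Proof.
move=> trsT0 liftT gs; move def_s: (base s) => s0 st.
elim: st s def_s gs => [x y xy|x|x y z _ IHx _ IHy] s def_x gs; subst x.
- have [t' st' def_t'] := raise_step_sim trsT0 liftT gs xy.
  exists t'; split=> //; first exact: rt_step.
  exact: gwf_rstep trsT0 xy gs.
- by exists s; split=> //; apply: rt_refl.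
have [u [su def_y gy]] := IHx s erefl gs; rewrite -def_y in gy.
have [v [uv def_z gz]] := IHy u def_y gy.
by exists v; split=> //; apply: rt_trans su uv.
Qed.

End Simulation.

(** * Descent along R/S-steps *)

Section Bounded.
Variables (F : signature) (R S : rules F) (c : nat).
Hypotheses (trsR : is_TRS R) (trsS : is_TRS S).
Hypotheses (ndR : non_duplicating R) (ndS : non_duplicating S).
Hypothesis ncR : ~ collapsing R.
Implicit Types s t u v : term (F * nat).
Local Notation stepR := (@raise_step F (match_rules R)).
Local Notation stepS := (@raise_step F (matchRT_rules c S)).
Local Notation rewr := (relative (rstep R) (rstep S)).

Lemma relative_sim s (t : term F) : gwf (base s) -> rewr (base s) t ->
  exists u v t', [/\ star stepS s u, stepR u v, star stepS v t' &
    [/\ base t' = t, gwf t & gwf (base v)]].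
Proof.
move=> gs [u0 [v0 [su uv vt]]].
have liftS l r l' : S (l, r) -> base l' = l ->
    exists d, matchRT_rules c S (l', lift_term d r).
  by move=> Slr def_l; eexists; exists l', r; split; first rewrite def_l.
have liftR l r l' : R (l, r) -> base l' = l ->
    exists d, match_rules R (l', lift_term d r).
  by move=> Rlr def_l; eexists; exists l, r, l'; split.
have [u [su' def_u gu]] := star_raise_step_sim trsS liftS gs su.
rewrite -def_u in uv gu.
have [v uv' def_v] := raise_step_sim trsR liftR gu uv.
have gv := gwf_rstep trsR uv gu; rewrite -def_v in vt gv.
have [t' [vt' def_t gt]] := star_raise_step_sim trsS liftS gv vt.
by exists u, v, t'.
Qed.

(** The number of symbols of height at most [k]; unlike the number of those of height exactly [k],
    it comes from an antitone weight. *)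
Definition counts s k := weight (fun h => h <= k) s.

Lemma descends_lexdrop K m s t : m <= c -> descends c K m s t ->
  lexdrop c m (counts t) (counts s).
Proof.
(* For [k <= m] the new symbols of height [m.+1] are not counted, however many there are; the lost
   one is counted only for [k = m]. *)
move=> le_mc st; have low k : k < c -> k <= m ->
    counts t k + (m <= k) <= counts s k.
  move=> lt_kc le_km; have /= := st (fun h => h <= k).
  rewrite (ltnNge m k) le_km muln0 addn0; apply=> [i j /= le_ji|].
    by case: (leqP i k) => // /(leq_trans le_ji) ->.
  by rewrite leqNgt lt_kc.
split=> [k lt_km|lt_mc].
  exact: leq_trans (leq_addr _ _) (low k (leq_trans lt_km le_mc) (ltnW lt_km)).
by have := low m lt_mc (leqnn m); rewrite leqnn addn1.
Qed.

Lemma stepS_lexdrop s t : star stepS s t ->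
  exists2 m, m <= c & lexdrop c m (counts t) (counts s).
Proof.
elim=> {s t} [s t|s|s t u _ [m1 le1 st] _ [m2 le2 tu]].
- move=> /(matchRT_step_descends trsS ndS) [_ [r [m [_ le_mc st]]]].
  by exists m => //; apply: descends_lexdrop st.
- by exists c => //; split=> //; rewrite ltnn.
exists (minn m2 m1); last exact: lexdrop_trans tu st.
by rewrite geq_min le2.
Qed.

Lemma lexlt_relative s u v t : star stepS s u -> stepR u v -> star stepS v t ->
  (forall p, p \in fpos v -> height_at v p <= c) ->
  lexlt c (counts t) (counts s).
Proof.
move=> /stepS_lexdrop [m1 _ su] uv /stepS_lexdrop [m3 _ vt] hv.
have [l [r [m2 [_ lt_mc uv']]]] := match_step_descends trsR ndR ncR hv uv.
have {}uv := descends_lexdrop (ltnW lt_mc) uv'.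
(* The R-step has a drop index below [c], hence so has the composition. *)
exists (minn m3 (minn m2 m1)); first by rewrite !gtn_min lt_mc orbT.
exact/(lexdrop_trans vt)/(lexdrop_trans uv).
Qed.

(** * Numerical weights for the linear bound *)

Section Size.
Variable M : nat.
Hypothesis M_ub : forall l r, (R `|` S) (l, r) -> fun_size r <= M.

(* The solution of w m = M * w m.+1 + 1 for m < c with w c = 0. *)
Definition bound_weight h := iter (c - h) (fun n => (M * n).+1) 0.

Lemma bound_weight_antitone : {homo bound_weight : i j /~ i <= j}.
Proof.
move=> i j; rewrite /bound_weight => /(leq_sub2l c).
move: (c - i) (c - j) => m n le_mn.
rewrite -(subnK le_mn); elim: (n - m) => // k IHk; apply: leq_trans IHk _.
(* One more iteration never lowers the value: the iterated map is monotone and starts from 0. *)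
rewrite addSn; elim: (k + m) => // q IHq.
by rewrite /= ltnS leq_mul2l; apply/orP; right.
Qed.

Lemma bound_weight_last h : c <= h -> bound_weight h = 0.
Proof. by rewrite /bound_weight -subn_eq0 => /eqP->. Qed.

Lemma descends_bound_weight K m s t : K <= M -> m <= c -> descends c K m s t ->
  weight bound_weight t + (m < c) <= weight bound_weight s.
Proof.
move=> le_KM le_mc st.
have := st _ bound_weight_antitone (bound_weight_last (leqnn c)).
have le_K : K * bound_weight m.+1 <= M * bound_weight m.+1.
  by rewrite leq_mul2r le_KM orbT.
case: ltnP => [lt_mc|le_cm].
  (* One symbol of height [m] outweighs [M] symbols of height [m.+1] by exactly 1. *)
  have -> : bound_weight m = (M * bound_weight m.+1).+1.
    by rewrite /bound_weight -(subnSK lt_mc).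
  by move: le_K; lia.
by rewrite [bound_weight m.+1]bound_weight_last ?muln0 ?leqW //; lia.
Qed.

Lemma stepS_bound_weight s t : star stepS s t ->
  weight bound_weight t <= weight bound_weight s.
Proof.
elim=> {s t} // [s t|s t u _ le_ts _]; last by move/leq_trans; apply.
move=> /(matchRT_step_descends trsS ndS) [l [r [m [Slr le_mc st]]]].
apply: leq_trans (leq_addr (m < c) _) _.
by apply: descends_bound_weight st => //; apply: (M_ub (l := l)); right.
Qed.

Lemma relative_bound_weight s u v t :
  star stepS s u -> stepR u v -> star stepS v t ->
  (forall p, p \in fpos v -> height_at v p <= c) ->
  weight bound_weight t < weight bound_weight s.
Proof.
move=> /stepS_bound_weight su uv /stepS_bound_weight vt hv.
have [l [r [m [Rlr lt_mc uv']]]] := match_step_descends trsR ndR ncR hv uv.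
apply: leq_ltn_trans vt (leq_trans _ su); rewrite -addn1.
have := descends_bound_weight (M_ub (or_introl Rlr)) (ltnW lt_mc) uv'.
by rewrite lt_mc.
Qed.

End Size.

(** * Labelled terms following R/S-sequences from L *)

Variable L : set (term F).
Hypothesis groundL : L `<=` @ground_terms F.
Hypothesis bounded : forall t,
    Succ (matchRT_step R S c) [set lift_term 0 s | s in L] t ->
    forall p, p \in fpos t -> height_at t p <= c.

(* The terms in the middle of an R/S-step need not be in [Succ], so no height
   bound is available for them; only the term after the R-step is in [Succ]. *)
Definition reachable s := gwf (base s) /\
  exists2 s0, [set lift_term 0 s | s in L] s0 & star (matchRT_step R S c) s0 s.

Lemma reachable_lift (t : term F) : L t -> reachable (lift_term 0 t).
Proof.
move=> Lt; split; last by exists (lift_term 0 t); [exists t | apply: rt_refl].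
by rewrite base_lift gwfE; have [-> ->] := groundL Lt.
Qed.

Lemma reachable_step s (t : term F) : reachable s -> rewr (base s) t ->
  exists u v t', [/\ star stepS s u, stepR u v, star stepS v t' &
    [/\ base t' = t, reachable t' & forall p, p \in fpos v -> height_at v p <= c]].
Proof.
move=> [gs [s0 Ls0 s0s]] /(relative_sim gs).
move=> [u [v [t' [su uv vt [def_t gt gv]]]]]; exists u, v, t'; split=> //; split=> //.
  split; first by rewrite def_t.
  exists s0 => //; apply: rt_trans s0s (rt_step _ _ _ _ _).
  by exists u, v.
(* With an empty final S-part, [v] is itself the result of a labelled R/S-step. *)
apply: bounded; split.
  by move: gv; rewrite gwfE vars_map_sym => /andP [_ /eqP].
exists s0 => //; apply: rt_trans s0s (rt_step _ _ _ _ _).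
by exists u, v; split=> //; apply: rt_refl.
Qed.

Lemma relative_terminating : terminating_on rewr L.
Proof.
move=> [a La0 a_step].
(* Well-founded induction on the counts of a labelled term over [a i]; each step passes to one over
   [a i.+1] with smaller counts. *)
have no_seq f : forall s i, counts s = f -> reachable s -> base s <> a i.
  elim: {f}(lexlt_wf c f) => f _ IH s i def_f rs def_s; subst f; move: (a_step i).
  rewrite -def_s => /(reachable_step rs) [u [v [t [su uv vt [def_t rt hv]]]]].
  exact: IH (lexlt_relative su uv vt hv) t i.+1 erefl rt def_t.
by apply: (no_seq _ _ 0 erefl (reachable_lift La0)); rewrite base_lift.
Qed.

Lemma relative_length M m (t u : term F) :
  (forall l r, (R `|` S) (l, r) -> fun_size r <= M) ->
  L t -> rpow rewr m t u -> m <= bound_weight M 0 * term_size t.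
Proof.
move=> M_ub Lt tu; apply: (@leq_trans (weight (bound_weight M) (lift_term 0 t))).
  have := reachable_lift Lt; move: tu; rewrite -[in rpow _ _ t](base_lift 0 t).
  elim: m (lift_term 0 t) => // m IH s [t1 st tu] rs.
  have [u' [v [t' [su uv vt [def_t rt hv]]]]] := reachable_step rs st.
  apply: leq_ltn_trans (relative_bound_weight M_ub su uv vt hv).
  by apply: IH; rewrite ?def_t.
by rewrite weight_lift mulnC leq_mul2l fun_size_le_term_size orbT.
Qed.
End Bounded.

Theorem theorem5p12 (F : signature) (R S : rules F) (L : set (term F))
  (trsR : is_TRS R) (trsS : is_TRS S)
  (ndRS : non_duplicating (R `|` S)) (ncR : ~ collapsing R)
  (groundL : L `<=` @ground_terms F)
  (bounded : match_raise_RT_bounded R S L) :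
  terminating_on (relative (rstep R) (rstep S)) L /\
  (finite_set R -> finite_set S ->
   linearly_bounded (fun n => cp n (relative (rstep R) (rstep S)) L)).
Proof.
have [c bounded_c] := bounded.
have ndR : non_duplicating R by move=> l r Rlr; apply: ndRS; left.
have ndS : non_duplicating S by move=> l r Slr; apply: ndRS; right.
split; first exact: (relative_terminating trsR trsS ndR ndS ncR groundL bounded_c).
move=> finR finS; have [|M M_ub] := finite_rules_bounded (T := R `|` S).
  by rewrite finite_setU.
(* The slope is the weight of a symbol of height 0, the height of all symbols in lifted start
   terms. *)
exists (bound_weight c M 0), 0 => n _; apply: ele_esup => _ [t [Lt le_tn ->]].
apply: ele_esup => _ [m [-> [u tu]]] /=.
have := relative_length trsR trsS ndR ndS ncR groundL bounded_c M_ub Lt tu.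
by move/leq_trans; apply; rewrite leq_mul2l le_tn orbT.
Qed.
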